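(* Let $N$ be a regular ruled surface in $E^3$ with parametrization $\vec r(s,v)=\vec c(s)+v\vec q(s)$, $\|\vec q(s)\|=1$, where $\vec c$ is the striction curve of $N$ and $s$ is the arc length parameter of $\vec c$, with Frenet frame $\{\vec q,\vec h,\vec a\}$ and non-zero invariants $k_1,k_2$, and suppose that the first curvature is $k_1\equiv 1$. Then $N$ is an $h$-slant ruled surface if and only if the second curvature is given by $$k_2(s)=\pm\frac{s}{\sqrt{\tan^2\varphi-s^2}},$$ where $\varphi$ is the constant angle between the central normal $\vec h$ and the fixed direction in the definition of an $h$-slant ruled surface.
   Context: $E^3$ is Euclidean 3-space; all maps are smooth and defined on an open interval $I\subset\mathbb R$. $N$ is given by $\vec r(s,v)=\vec c(s)+v\vec q(s)$, where $\vec c$ is a unit speed curve and $\vec q$ is a unit vector field along $\vec c$ (the ruling). ''Regular'' refers to the base curve $\vec c$ being a regular curve. That $\vec c$ is the striction curve means $\langle \vec c\,',\vec q\,'\rangle=0$. Frenet frame of $N$: $\vec a=\dfrac{\vec q\times\vec q\,'}{\|\vec q\,'\|}$ (central tangent), $\vec h=\vec a\times\vec q$ (central normal). The invariants $k_1,k_2$ (first and second curvature) are the functions in the Frenet formulae $$\vec q\,'=k_1\vec h,\qquad \vec h'=-k_1\vec q+k_2\vec a,\qquad \vec a'=-k_2\vec h,$$ with $'=d/ds$; both are assumed non-zero. $N$ is called $h$-slant if the central normal $\vec h$ makes a constant angle $\varphi\neq\pi/2$ with a fixed non-zero direction, i.e. there is a fixed unit vector $\vec u$ with $\langle\vec h(s),\vec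 u\rangle=\cos\varphi=$ constant, $\varphi\neq\pi/2$.
   Formalization: The formula for the second curvature is proved with s replaced by s − s0 for some constant s0, since the arc length parameter is fixed only up to its origin; with an arbitrary fixed origin the ''only if'' direction is false. *)

(* Defs.v *)
From HB Require Import structures.
From mathcomp Require Import all_boot all_order all_algebra.
From mathcomp Require Import all_classical all_reals all_analysis.

Set Implicit Arguments.
Unset Strict Implicit.
Unset Printing Implicit Defensive.

Import Order.TTheory GRing.Theory Num.Theory.
Import numFieldNormedType.Exports.

Local Open Scope classical_set_scope.
Local Open Scope ring_scope.

Section EuclideanSpace.
Context {R : realType}.
Implicit Types u v : 'rV[R]_3.

Definition dotv u v : R := \sum_(i < 3) u 0 i * v 0 i.

(* The library norm [`|u|] on row vectors is the sup norm, so the Euclidean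
   norm has to be defined separately. The topology, hence differentiation, is
   the same for both. *)
Definition enorm u : R := Num.sqrt (dotv u u).

Definition crossv u v : 'rV[R]_3 :=
  \row_(k < 3) [:: u 0 1 * v 0 2%:R - u 0 2%:R * v 0 1;
                   u 0 2%:R * v 0 0 - u 0 0 * v 0 2%:R;
                   u 0 0 * v 0 1 - u 0 1 * v 0 0]`_k.

(* For open [I], nothing is required of [f] outside [I]. *)
Definition smooth_on (I : set R) (f : R -> 'rV[R]_3) : Prop :=
  forall (n : nat) (s : R), I s -> derivable (derive1n n f) s 1.

End EuclideanSpace.

Record ruled_surface (R : realType) := RuledSurface {
  dom : set R;
  base : R -> 'rV[R]_3;
  ruling : R -> 'rV[R]_3;
  dom_open : open dom;
  dom_interval : is_interval dom;
  dom_nonempty : dom !=set0;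
  base_smooth : smooth_on dom base;
  ruling_smooth : smooth_on dom ruling;
  ruling_unit : forall s, dom s -> enorm (ruling s) = 1
}.

Section RuledSurfaces.
Context {R : realType}.
Implicit Types N : ruled_surface R.

Definition param N (s v : R) : 'rV[R]_3 := base N s + v *: ruling N s.

Definition regular N : Prop :=
  forall s, dom N s -> derive1 (base N) s != 0.

Definition arc_length N : Prop :=
  forall s, dom N s -> enorm (derive1 (base N) s) = 1.

Definition striction N : Prop :=
  forall s, dom N s -> dotv (derive1 (base N) s) (derive1 (ruling N) s) = 0.

Definition central_tangent N (s : R) : 'rV[R]_3 :=
  (enorm (derive1 (ruling N) s))^-1 *:
    crossv (ruling N s) (derive1 (ruling N) s).

Definition central_normal N (s : R) : 'rV[R]_3 :=
  crossv (central_tangent N s) (ruling N s).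

(* [k1] and [k2] are determined by these equations only on [dom N].
   The first conjunct says that the frame exists: its definition divides by
   the norm of the derivative of the ruling. *)
Definition frenet_curvatures N (k1 k2 : R -> R) : Prop :=
  forall s, dom N s ->
    [/\ derive1 (ruling N) s != 0,
        is_derive s 1 (ruling N) (k1 s *: central_normal N s),
        is_derive s 1 (central_normal N)
          (- k1 s *: ruling N s + k2 s *: central_tangent N s) &
        is_derive s 1 (central_tangent N) (- k2 s *: central_normal N s)].

Definition slant_angle (phi : R) : Prop :=
  0 <= phi <= pi /\ phi <> pi / 2.

Definition h_slant_with_angle N (phi : R) : Prop :=
  exists u : 'rV[R]_3,
    enorm u = 1 /\
    forall s, dom N s -> dotv (central_normal N s) u = cos phi.

Definition h_slant N : Prop :=
  exists phi, slant_angle phi /\ h_slant_with_angle N phi.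

(* k2(s) = +- s / sqrt (tan^2 phi - s^2), with one sign for the whole interval.
   An arc length parameter is only determined up to its origin, which this
   formula fixes: [s0] is the parameter value of that origin. The inequality
   says that the right-hand side is meaningful, since [Num.sqrt] and [^-1] are
   total functions. *)
Definition slant_second_curvature N (k2 : R -> R) (phi : R) : Prop :=
  exists s0 eps : R, (eps = 1 \/ eps = -1) /\
    forall s, dom N s ->
      (s - s0) ^+ 2 < tan phi ^+ 2 /\
      k2 s = eps * ((s - s0) / Num.sqrt (tan phi ^+ 2 - (s - s0) ^+ 2)).

End RuledSurfaces.

(* Main.v *)
(* With k1 = 1 the frame satisfies q' = h, h' = -q + k2 a, a' = -k2 h, where
   a = q x h. Put c = cos phi, a nonzero number, t = s - s0 and
   T = tan phi.
   If <h,u> = c is constant, then <q,u>' = c gives <q,u> = c t for a suitable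
   s0, while <h,u>' = 0 gives k2 <a,u> = c t. Expanding |u| = 1 in the
   orthonormal frame yields (<a,u>/c)^2 = T^2 - t^2. This cannot vanish: a zero
   forces T = 0, hence t = 0 on a whole open interval. So <a,u>/c is
   continuous without zeros and has a constant sign.
   Conversely u = c (t q + h + eps sqrt(T^2 - t^2) a) has derivative 0,
   satisfies <h,u> = c, and has squared norm c^2 (1 + T^2) = 1. *)
Require Import Defs.
From mathcomp Require Import all_boot all_order all_algebra.
From mathcomp Require Import all_classical all_reals all_analysis.
From mathcomp Require Import ring lra.

Import Order.TTheory GRing.Theory Num.Theory.
Import numFieldNormedType.Exports.

Local Open Scope ring_scope.

(** * Identities for the dot and cross products, by coordinates *)

Section EuclideanSpace.
Context {R : realType}.
Implicit Types u v w : 'rV[R]_3.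

Lemma dotvE u v :
  dotv u v = u 0 0 * v 0 0 + u 0 1 * v 0 1 + u 0 2%:R * v 0 2%:R.
Proof.
by rewrite /dotv !big_ord_recl big_ord0 addr0 addrA;
  congr (_ + _ * _ + _ * _); congr (_ _ _); apply/val_inj.
Qed.

Lemma crossvE u v :
  (crossv u v 0 0 = u 0 1 * v 0 2%:R - u 0 2%:R * v 0 1) *
  (crossv u v 0 1 = u 0 2%:R * v 0 0 - u 0 0 * v 0 2%:R) *
  (crossv u v 0 2%:R = u 0 0 * v 0 1 - u 0 1 * v 0 0).
Proof. by rewrite !mxE. Qed.

Lemma dotvC u v : dotv u v = dotv v u.
Proof. by rewrite !dotvE; ring. Qed.

Lemma dotvDl u v w : dotv (u + v) w = dotv u w + dotv v w.
Proof. by rewrite !dotvE !mxE; ring. Qed.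

Lemma dotvZl k u v : dotv (k *: u) v = k * dotv u v.
Proof. by rewrite !dotvE !mxE; ring. Qed.

Lemma dotvNl u v : dotv (- u) v = - dotv u v.
Proof. by rewrite !dotvE !mxE; ring. Qed.

Lemma dotv_ge0 u : 0 <= dotv u u.
Proof. by apply: sumr_ge0 => i _; rewrite -expr2 sqr_ge0. Qed.

Lemma dotv_eq0 u : (dotv u u == 0) = (u == 0).
Proof.
apply/eqP/eqP => [u0|->]; last by rewrite dotvE !mxE; ring.
apply/rowP => i; rewrite mxE; apply/eqP; rewrite -sqrf_eq0 expr2.
by have /psumr_eq0P -> := u0; rewrite // => j _; rewrite -expr2 sqr_ge0.
Qed.

Lemma enorm_eq1 u : (enorm u == 1) = (dotv u u == 1).
Proof.
by rewrite -[in LHS](sqrtr1 R) /enorm eqr_sqrt ?dotv_ge0.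
Qed.

Lemma dotv_crossl u v : dotv (crossv u v) u = 0.
Proof. by rewrite dotvE !crossvE; ring. Qed.

Lemma dotv_crossr u v : dotv (crossv u v) v = 0.
Proof. by rewrite dotvE !crossvE; ring. Qed.

Lemma dotv_cross u v :
  dotv (crossv u v) (crossv u v) = dotv u u * dotv v v - dotv u v ^+ 2.
Proof. by rewrite !dotvE !crossvE; ring. Qed.

(* The squared determinant of (q, h, u) is its Gram determinant. *)
Lemma dotv_orthonormal_frame q h u :
  dotv q q = 1 -> dotv h h = 1 -> dotv h q = 0 ->
  dotv q u ^+ 2 + dotv h u ^+ 2 + dotv (crossv q h) u ^+ 2 = dotv u u.
Proof.
move=> qq hh hq.
have -> : dotv (crossv q h) u ^+ 2 =
    dotv q q * (dotv h h * dotv u u - dotv h u ^+ 2)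
    - dotv h q * (dotv h q * dotv u u - dotv h u * dotv q u)
    + dotv q u * (dotv h q * dotv h u - dotv h h * dotv q u).
  by rewrite !dotvE !crossvE; ring.
by rewrite qq hh hq; ring.
Qed.

End EuclideanSpace.

(** * Scalar calculus on intervals, and trigonometry of the slant angle *)

Section Calculus.
Local Open Scope classical_set_scope.
Context {R : realType}.

Lemma is_derive_mx_coord m n (f : R -> 'M[R]_(m.+1, n.+1)) (x : R) df i j :
  is_derive x 1 f df -> is_derive x 1 (fun t => f t i j) (df i j).
Proof.
move=> f_df; have /derivable_mxP fx : derivable f x 1 by [].
apply: DeriveDef; first exact: fx.
by have <- : 'D_1 f x = df; [exact: derive_val | rewrite derive_mx// mxE].
Qed.

Lemma is_derive_dotv (u : 'rV[R]_3) (f : R -> 'rV[R]_3) (x : R) df :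
  is_derive x 1 f df -> is_derive x 1 (fun t => dotv (f t) u) (dotv df u).
Proof.
move=> f_df; have fi i := is_derive_mx_coord _ _ f x df 0 i f_df.
rewrite dotvE; under eq_fun do rewrite dotvE.
apply: is_derive_eq; rewrite /GRing.scale/=; ring.
Qed.

Lemma within_itv_continuous (I : set R) (f : R -> R) (a b : R) :
  is_interval I -> (forall x, I x -> {for x, continuous f}) ->
  I a -> I b -> {within `[a, b], continuous f}.
Proof.
move=> II cf Ia Ib; apply: continuous_in_subspaceT => x.
by rewrite inE/= in_itv/= => xab; apply: cf; exact: II xab.
Qed.

Lemma is_derive0_interval_cst (I : set R) (f : R -> R) :
  is_interval I -> (forall x, I x -> is_derive x 1 f 0) ->
  forall x y, I x -> I y -> f x = f y.
Proof.
move=> II f0.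
wlog xy : / forall x y, x <= y -> I x -> I y -> f x = f y.
  apply=> x y xy Ix Iy.
  have [||z _ /eqP] := MVT_segment xy (df := fun=> 0) (f := f).
  - move=> z; rewrite in_itv/= => /andP[xz zy].
    by apply/f0/(II _ _ Ix Iy); rewrite (ltW xz) ltW.
  - apply: (within_itv_continuous I) => // z /f0 fz.
    exact/differentiable_continuous/derivable1_diffP.
  - by rewrite mul0r subr_eq0 => /eqP.
move=> x y Ix Iy; case: (leP x y) => [|/ltW] le; first exact: xy.
by apply/esym/xy.
Qed.

(** By the intermediate value theorem, two values whose product is not positive would force a zero
    between them. So every value has the sign of [f x0] at a reference point [x0], and [eps] is that
    sign; for empty [I] the choice is arbitrary. *)
Lemma interval_constant_sign (I : set R) (f : R -> R) :
  is_interval I -> (forall x, I x -> {for x, continuous f}) ->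
  (forall x, I x -> f x != 0) ->
  exists eps : R, (eps = 1 \/ eps = -1) /\ forall x, I x -> f x = eps * `|f x|.
Proof.
move=> II cf f0; have [[x0 Ix0]|I0] := pselect (exists x, I x); last first.
  by exists 1; split=> [|x Ix]; [left|case: I0; exists x].
have same x y : x <= y -> I x -> I y -> 0 < f x * f y.
  move=> xy Ix Iy; rewrite ltNge; apply/negP => fxy.
  have [||z zxy fz0] := @IVT R f x y 0 xy.
  - exact: (within_itv_continuous I).
  - have := f0 _ Ix; have := f0 _ Iy.
    rewrite ge_min le_max; case: (ltgtP (f x) 0) => //= fx _ _; case: (ltgtP (f y) 0) => //= fy.
    + by move: fxy; rewrite leNgt nmulr_rgt0// fy.
    + by move: fxy; rewrite leNgt pmulr_rgt0// fy.
  - have Iz : I z by apply: (II _ _ Ix Iy); move: zxy; rewrite in_itv.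
    by have := f0 _ Iz; rewrite fz0 eqxx.
have {}same x : I x -> 0 < f x0 * f x.
  by move=> Ix; case: (leP x x0) => [|/ltW] le; [rewrite mulrC|]; exact: same.
exists (Num.sg (f x0)); split.
  by case: sgrP (f0 _ Ix0) => //; [left|right].
move=> x Ix; rewrite {1}(numEsg (f x)); congr (_ * _).
by case: (sgrP (f x0)) (same _ Ix) => [->|fx0|fx0]; rewrite ?mul0r ?ltxx//;
  rewrite ?(pmulr_rgt0 _ fx0) ?(nmulr_rgt0 _ fx0); [move/gtr0_sg|move/ltr0_sg].
Qed.

(** Nothing is known of [f] outside [I]; openness makes [f] agree with a constant near [x], which is
    enough to fix the derivative. *)
Lemma is_derive_locally_cst (I : set R) (f : R -> R) (k x df : R) :
  open I -> (forall t, I t -> f t = k) -> I x -> is_derive x 1 f df -> df = 0.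
Proof.
move=> oI fk Ix f_df; have nI : \near x, f x = k.
  by apply: filterS (open_nbhs_nbhs (conj oI Ix)).
have <- : 'D_1 f x = df by exact: derive_val.
by rewrite (near_eq_derive _ nI) derive_cst.
Qed.

Lemma open_not_singleton (I : set R) (x : R) :
  open I -> I x -> exists2 y, I y & y != x.
Proof.
move=> oI Ix; have /nbhs_ballP[e /= e0 xeI] := oI _ Ix.
exists (x + e / 2).
  by apply: xeI; rewrite /ball/= opprD addNKr normrN gtr0_norm//; lra.
by rewrite -subr_eq0 addrAC subrr add0r gt_eqF//; lra.
Qed.

(** Cosine is injective on [0, pi], so pi / 2 is its only zero there. *)
Lemma slant_angle_cos_neq0 (phi : R) : slant_angle phi -> cos phi != 0.
Proof.
move=> [/andP[phi0 phipi] phineq]; apply/eqP => /eqP.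
rewrite -cos_pihalf => /eqP /cos_inj; rewrite !in_itv/= phi0 phipi => /(_ isT) h.
apply: phineq; apply: h; have := pi_gt0 R => pi0; apply/andP; split; lra.
Qed.

Lemma tan_sqr (phi : R) : cos phi != 0 ->
  cos phi ^+ 2 * (1 + tan phi ^+ 2) = 1.
Proof. by move=> c0; rewrite -cos2_tan2// divff// sqrf_eq0. Qed.

End Calculus.

(** * Ruled surfaces with first curvature 1: the two implications *)

Section UnitFirstCurvature.
Context {R : realType} (N : ruled_surface R) (k1 k2 : R -> R)
  (N_frenet : frenet_curvatures N k1 k2)
  (k1_eq1 : forall s, dom N s -> k1 s = 1).

Local Notation q := (ruling N).
Local Notation h := (central_normal N).
Local Notation a := (central_tangent N).

Lemma unit_curvature_is_derive s : dom N s ->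
  [/\ is_derive s 1 q (h s), is_derive s 1 h (- q s + k2 s *: a s) &
      is_derive s 1 a (- k2 s *: h s)].
Proof.
by move=> Is; have [_] := N_frenet s Is; rewrite k1_eq1// scaleN1r scale1r.
Qed.

(** Normalisation makes [a] a unit vector orthogonal to [q], hence [h], the cross product of [a] and
    [q], is a unit vector too. Since q' = h, the factor dividing by the norm of q' in the definition
    of [a] is then 1. *)
Lemma unit_curvature_frame s : dom N s ->
  [/\ dotv (q s) (q s) = 1, dotv (h s) (h s) = 1, dotv (h s) (q s) = 0 &
      a s = crossv (q s) (h s)].
Proof.
move=> Is; have [q'_neq0 _ _ _] := N_frenet s Is.
have [q'h _ _] := unit_curvature_is_derive s Is.
have q'E : derive1 q s = h s by rewrite derive1E derive_val.
have qq : dotv (q s) (q s) = 1.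
  by apply/eqP; rewrite -enorm_eq1; apply/eqP/ruling_unit.
have hq : dotv (h s) (q s) = 0 by exact: dotv_crossr.
have aE : a s = (enorm (h s))^-1 *: crossv (q s) (h s).
  by rewrite /central_tangent q'E.
have hh : dotv (h s) (h s) = 1.
  have hh0 : dotv (h s) (h s) != 0 by rewrite dotv_eq0 -q'E.
  have aa : dotv (a s) (a s) = 1.
    rewrite aE dotvZl dotvC dotvZl dotv_cross qq dotvC hq expr0n subr0 mul1r.
    by rewrite mulrA -expr2 exprVn sqr_sqrtr ?dotv_ge0// mulVf.
  have aq : dotv (a s) (q s) = 0 by rewrite aE dotvZl dotv_crossl mulr0.
  by rewrite [in LHS]/central_normal dotv_cross aa qq aq; ring.
split=> //; rewrite aE.
by rewrite /enorm hh sqrtr1 invr1 scale1r.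
Qed.

Lemma h_slant_second_curvature phi : slant_angle phi ->
  h_slant_with_angle N phi -> slant_second_curvature N k2 phi.
Proof.
move=> /slant_angle_cos_neq0 c0 [u [/eqP]]; rewrite enorm_eq1 => /eqP uu hu.
have [s1 Is1] := dom_nonempty N.
set c := cos phi in c0 hu *; set T2 := tan phi ^+ 2.
have cT : c ^+ 2 * (1 + T2) = 1 by exact: tan_sqr.
pose x s := dotv (q s) u; pose z s := dotv (a s) u / c.
(* The origin is chosen so that [x s = c * (s - s0)] holds at the reference point [s1]; equality of
   derivatives extends it to the whole interval. *)
pose s0 := s1 - x s1 / c.
have xE s : dom N s -> x s = c * (s - s0).
  move=> Is; pose f t := x t - c * t.
  have : f s = f s1.
    apply: (is_derive0_interval_cst (dom N)) => //; first exact: dom_interval.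
    move=> t It; have [/(is_derive_dotv u) x' _ _] := unit_curvature_is_derive t It.
    rewrite hu// in x'; rewrite /f /x.
    by apply: is_derive_eq; rewrite /GRing.scale/=; ring.
  rewrite /f => fE; have -> : x s = x s1 - c * s1 + c * s by rewrite -fE; ring.
  by rewrite /s0; field.
have k2z s : dom N s -> k2 s * z s = s - s0.
  move=> Is; have [_ /(is_derive_dotv u) h' _] := unit_curvature_is_derive s Is.
  have : dotv (- q s + k2 s *: a s) u = 0.
    apply: (is_derive_locally_cst (dom N) (fun t => dotv (h t) u) c s _ _ hu) => //.
    exact: dom_open.
  rewrite dotvDl dotvNl (dotvZl (k2 s)) -/(x s) xE// => /eqP.
  by rewrite addrC subr_eq0 /z => /eqP e; rewrite mulrA e; field.
have zz s : dom N s -> z s ^+ 2 = T2 - (s - s0) ^+ 2.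
  move=> Is; have [qq hh hq aE] := unit_curvature_frame s Is.
  have := dotv_orthonormal_frame (q s) (h s) u qq hh hq.
  rewrite uu -aE hu// -/(x s) xE// => e.
  (* Writing |u|^2 = 1 as [c ^+ 2 * (1 + T2)] makes the contribution [c ^+ 2] of [h] cancel. *)
  have ae : dotv (a s) u ^+ 2 = c ^+ 2 * (T2 - (s - s0) ^+ 2).
    by apply: (@addrI _ ((c * (s - s0)) ^+ 2 + c ^+ 2)); rewrite e -cT; ring.
  by rewrite /z expr_div_n ae mulrC mulKf// sqrf_eq0.
(* A zero of [z] gives [s = s0] by [k2z], so [T2 = 0] by [zz]. Then [z t ^+ 2] is minus a square for
   every [t], which leaves [s0] as the only point of the open domain. *)
have z0 s : dom N s -> z s != 0.
  move=> Is; apply/eqP => zs.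
  have t0 := k2z s Is; rewrite zs mulr0 in t0.
  have := zz s Is; rewrite zs -t0 => /eqP; rewrite expr0n/= subr0 eq_sym => /eqP T0.
  have ss0 t : dom N t -> t = s0.
    move=> /zz; rewrite T0 => zt; apply/eqP; rewrite -subr_eq0 -sqrf_eq0.
    by have := sqr_ge0 (z t); rewrite zt sub0r oppr_ge0 eq_le sqr_ge0 andbT.
  have [t It] := open_not_singleton (dom N) s (@dom_open _ N) Is.
  by rewrite (ss0 t It) (ss0 s Is) eqxx.
(* The side goal, continuity of [z], comes from the differentiability of [a]. *)
have [s Is|eps [epsE zE]] := interval_constant_sign (dom N) z (@dom_interval _ N) _ z0.
  have [_ _ /(is_derive_dotv u) a'] := unit_curvature_is_derive s Is.
  apply/differentiable_continuous/derivable1_diffP; rewrite /z.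
  exact: ex_derive.
exists s0, eps; split=> // s Is; rewrite -/T2 -zz//; split.
  by rewrite -subr_gt0 -zz// lt_neqAle eq_sym sqrf_eq0 z0// sqr_ge0.
have eps1 : eps * eps = 1 by case: epsE => ->; ring.
have nz : `|z s| != 0 by rewrite normr_eq0 z0.
(* The square root is [|z s|], and [s - s0] is [k2 s * (eps * |z s|)]; the absolute values cancel
   and [eps] appears squared. *)
rewrite sqrtr_sqr -(k2z s Is) [X in k2 s * X](zE s Is).
by rewrite !mulrA mulfK// mulrAC eps1 mul1r.
Qed.

Lemma second_curvature_h_slant phi :
  slant_angle phi -> slant_second_curvature N k2 phi -> h_slant_with_angle N phi.
Proof.
move=> /slant_angle_cos_neq0 c0 [s0 [eps [epsE k2E]]].
have [s1 Is1] := dom_nonempty N.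
set c := cos phi in c0 *; set T2 := tan phi ^+ 2 in k2E.
have cT : c ^+ 2 * (1 + T2) = 1 by exact: tan_sqr.
have eps1 : eps * eps = 1 by case: epsE => ->; ring.
pose w s := Num.sqrt (T2 - (s - s0) ^+ 2).
(* The frame components are those which the converse implication forces on the fixed direction. *)
pose U s := c *: ((s - s0) *: q s + h s + (eps * w s) *: a s).
(* Strict positivity is what makes the square root differentiable. *)
have w_gt0 s : dom N s -> 0 < w s.
  by move=> /k2E[ts _]; rewrite sqrtr_gt0 subr_gt0.
have ww s : dom N s -> w s ^+ 2 = T2 - (s - s0) ^+ 2.
  by move=> /k2E[ts _]; rewrite sqr_sqrtr// subr_ge0 ltW.
have U_cst s : dom N s -> U s = U s1.
  move=> Is; apply/rowP => i; apply: (is_derive0_interval_cst (dom N) (fun s => U s 0 i)) => //.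
    exact: dom_interval.
  move=> {Is}s Is; have [q' h' a'] := unit_curvature_is_derive s Is.
  have q'i := is_derive_mx_coord _ _ _ _ _ 0 i q'.
  have h'i := is_derive_mx_coord _ _ _ _ _ 0 i h'.
  have a'i := is_derive_mx_coord _ _ _ _ _ 0 i a'.
  have w' : is_derive s 1 w (- (s - s0) / w s).
    have T2t : 0 < T2 - (s - s0) ^+ 2 by have [ts _] := k2E s Is; rewrite subr_gt0.
    have sqrt' := is_derive1_sqrt T2t.
    have g' : is_derive s 1 (fun s => T2 - (s - s0) ^+ 2) (- 2 * (s - s0)).
      by apply: is_derive_eq; rewrite /GRing.scale/=; ring.
    apply: (is_derive_eq (@is_derive1_comp _ _ (fun s => T2 - (s - s0) ^+ 2) _ _ _ sqrt' g')).
    by rewrite -/(w s); field; rewrite gt_eqF// w_gt0.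
  have coordE x y (u v v' : 'rV[R]_3) :
      (x *: u + v + y *: v') 0 i = x * u 0 i + v 0 i + y * v' 0 i.
    by rewrite !mxE.
  have coordZ k (u : 'rV[R]_3) : (k *: u) 0 i = k * u 0 i by rewrite mxE.
  have coordN (u v : 'rV[R]_3) k : (- u + k *: v) 0 i = - u 0 i + k * v 0 i.
    by rewrite !mxE.
  rewrite coordN in h'i; rewrite coordZ in a'i.
  rewrite /U; under eq_fun do rewrite coordZ coordE.
  apply: is_derive_eq; rewrite /GRing.scale/=.
  have w0 : w s != 0 by rewrite gt_eqF// w_gt0.
  have -> : k2 s = eps * ((s - s0) / w s) by have [_] := k2E s Is.
  (* The coefficients of [q] and [a] cancel directly; that of [h] is [(s - s0) * (1 - eps * eps)] up
     to the factor [c]. *)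
  by field: eps1.
have dotvU s v : dotv v (U s) = c * ((s - s0) * dotv (q s) v +
    dotv (h s) v + eps * w s * dotv (a s) v).
  by rewrite dotvC /U dotvZl !dotvDl (dotvZl (s - s0)) (dotvZl (eps * w s)).
exists (U s1); split=> [|s Is]; last first.
  rewrite -(U_cst s Is); have [qq hh hq aE] := unit_curvature_frame s Is.
  rewrite dotvU (dotvC (q s)) hq hh aE dotv_crossr.
  by rewrite -/c; ring.
(* The norm is computed in the orthonormal frame at [s1], where the components of [U s1] can be read
   off. *)
apply/eqP; rewrite enorm_eq1; have [qq hh hq aE] := unit_curvature_frame s1 Is1.
rewrite -(dotv_orthonormal_frame (q s1) (h s1))// -aE.
have hha : dotv (a s1) (h s1) = 0 by rewrite aE dotv_crossr.
have qa : dotv (a s1) (q s1) = 0 by rewrite aE dotv_crossl.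
have aa : dotv (a s1) (a s1) = 1.
  by rewrite aE dotv_cross qq hh dotvC hq; ring.
rewrite !dotvU (dotvC (q s1) (h s1)) (dotvC (q s1) (a s1)).
rewrite (dotvC (h s1) (a s1)) hha qa aa qq hh hq.
apply/eqP; rewrite -[RHS]cT.
have -> : T2 = (s1 - s0) ^+ 2 + w s1 ^+ 2 by rewrite ww//; ring.
have -> : w s1 ^+ 2 = (eps * w s1) ^+ 2 by rewrite exprMn (expr2 eps) eps1 mul1r.
by ring.
Qed.

End UnitFirstCurvature.

Theorem theorem4p2 (R : realType) (N : ruled_surface R) (k1 k2 : R -> R)
    (N_regular : regular N)
    (N_arc_length : arc_length N)
    (N_striction : striction N)
    (N_frenet : frenet_curvatures N k1 k2)
    (k1_neq0 : forall s, dom N s -> k1 s <> 0)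
    (k2_neq0 : forall s, dom N s -> k2 s <> 0)
    (k1_eq1 : forall s, dom N s -> k1 s = 1) :
  (h_slant N <->
     exists phi, slant_angle phi /\ slant_second_curvature N k2 phi) /\
  (forall phi, slant_angle phi ->
     (h_slant_with_angle N phi <-> slant_second_curvature N k2 phi)).
Proof.
have iff_phi phi : slant_angle phi ->
    h_slant_with_angle N phi <-> slant_second_curvature N k2 phi.
  move=> phiP; split; first exact: (h_slant_second_curvature _ _ _ N_frenet k1_eq1).
  exact: (second_curvature_h_slant _ _ _ N_frenet k1_eq1).
by split=> //; split=> -[phi [phiP /(iff_phi _ phiP) ?]]; exists phi.
Qed.
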